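(* For any compatible parameter sets $p_+$, $p_-$, $$\mathbf{E}\left(\lambda_1(p_+,p_-)\right)\le\inf_{R(p_+)<\alpha<R(p_-)^{-1}}\mathbf{E}\left(\lambda_1(p_+,p_-;\alpha,\alpha^{-1})\right),$$ where $\lambda_1(p_+,p_-)$ is the length of the longest increasing subsequence of the random multiset $M(p_+,p_-)$ and $\lambda_1(p_+,p_-;\alpha,\alpha^{-1})$ is the length of the longest increasing subsequence of the extended random multiset $M(p_+,p_-;\alpha_+,\alpha_-)$ with $\alpha_+=\alpha$, $\alpha_-=\alpha^{-1}$.
   Context: A parameter set is a triple $p=(t,q,r)$, where $t\ge 0$ is real and $q=(q_i)_{i\ge1}$, $r=(r_i)_{i\ge1}$ are sequences of nonnegative reals with $\sum_i q_i+\sum_i r_i<\infty$. Put $Q(p)=\sup_i q_i$, $R(p)=\sup_i r_i$ (with $0^{-1}=+\infty$). Parameter sets $p_+=(t^+,q^+,r^+)$ and $p_-=(t^-,q^-,r^-)$ are compatible if $Q(p_+)Q(p_-)<1$ and $R(p_+)R(p_-)<1$. Random variables: $P(s)$ is Poisson of mean $s$; $g(s)$ is geometric of parameter $s$, i.e. $\Pr(g(s)=k)=(1-s)s^k$ for $k\ge0$; $b(s)$ equals $1$ with probability $\frac{s}{1+s}$ and $0$ with probability $\frac1{1+s}$. Let $(\mathbb{Z}^+)'=\{1',2',\dots\}$ be a disjoint copy of $\mathbb{Z}^+=\{1,2,\dots\}$, and $\Omega=[0,1]\uplus\mathbb{Z}^+\uplus(\mathbb{Z}^+)'$. The random multiset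 $M(p_+,p_-)$ in $\Omega\times\Omega$ is obtained as follows, with all choices independent: - on $[0,1]\times[0,1]$: $P(t^+t^-)$ i.i.d. uniform points; - on $[0,1]\times\{i\}$: $P(t^+q^-_i)$ i.i.d. uniform points; on $[0,1]\times\{i'\}$: $P(t^+r^-_i)$ i.i.d. uniform points; on $\{i\}\times[0,1]$: $P(q^+_it^-)$ i.i.d. uniform points; on $\{i'\}\times[0,1]$: $P(r^+_it^-)$ i.i.d. uniform points; - the point $(i,j)$ has multiplicity $g(q^+_iq^-_j)$; $(i,j')$ has multiplicity $b(q^+_ir^-_j)$; $(i',j)$ has multiplicity $b(r^+_iq^-_j)$; $(i',j')$ has multiplicity $g(r^+_ir^-_j)$. Extended model: let $\Omega^+=\Omega\uplus\{\Sigma\}$. For $\alpha_+,\alpha_-\ge0$ with $\alpha_+R(p_-)<1$ and $\alpha_-R(p_+)<1$, the random multiset $M(p_+,p_-;\alpha_+,\alpha_-)$ in $\Omega^+\times\Omega^+$ consists of $M(p_+,p_-)$ on $\Omega\times\Omega$ together with, independently: - on $[0,1]\times\{\Sigma\}$: $P(\alpha_-t^+)$ i.i.d. uniform points; $(i,\Sigma)$ has multiplicity $b(\alpha_-q^+_i)$; $(i',\Sigma)$ has multiplicity $g(\alpha_-r^+_i)$; - on $\{\Sigma\}\times[0,1]$: $P(\alpha_+t^-)$ i.i.d. uniform points; $(\Sigma,i)$ has multiplicity $b(\alpha_+q^-_i)$; $(\Sigma,i')$ has multiplicity $g(\alpha_+r^-_i)$; - $(\Sigma,\Sigma)$ has multiplicity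 $0$. Fix two total orderings $\le_+$ and $\le_-$ on $\Omega$, each restricting to the usual order on $[0,1]$, and extend them to $\Omega^+$ by making $\Sigma$ the smallest element in both. (The orderings are otherwise arbitrary; the distributions considered do not depend on them.) A subsequence of a multiset $M$ is a finite sequence of points $(x_k,y_k)$ of $M$ in which no point occurs more often than its multiplicity in $M$. It is increasing if for all $k$ one has $x_k\le_+x_{k+1}$ and $y_k\le_-y_{k+1}$, and moreover $x_k=x_{k+1}$ implies $x_k\notin\mathbb{Z}^+$, and $y_k=y_{k+1}$ implies $y_k\notin\mathbb{Z}^+$ (so equality is allowed in $[0,1]$, in $(\mathbb{Z}^+)'$ and at $\Sigma$). Its length is its number of terms. $\lambda_1(p_+,p_-)$ and $\lambda_1(p_+,p_-;\alpha_+,\alpha_-)$ denote the maximal length of an increasing subsequence of $M(p_+,p_-)$ and of $M(p_+,p_-;\alpha_+,\alpha_-)$ respectively; both are finite with probability 1. *)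

(* Defs.v *)
From HB Require Import structures.
From mathcomp Require Import all_boot all_order all_algebra.
From mathcomp Require Import all_classical all_reals all_analysis.

Set Implicit Arguments.
Unset Strict Implicit.
Unset Printing Implicit Defensive.

Import Order.TTheory GRing.Theory Num.Theory.

Local Open Scope classical_set_scope.
Local Open Scope ring_scope.

(* The sequences indexed by {1,2,...} are indexed here by nat: the index i     *)
(* stands for i + 1.                                                          *)
Record params (R : realType) := Params {
  par_t : R ;
  par_q : nat -> R ;
  par_r : nat -> R ;
  par_t_ge0 : 0 <= par_t ;
  par_q_ge0 : forall i, 0 <= par_q i ;
  par_r_ge0 : forall i, 0 <= par_r i ;
  par_summable :
    (\sum_(0 <= i <oo) (par_q i)%:E + \sum_(0 <= i <oo) (par_r i)%:E < +oo)%E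
}.

Definition sup_q (R : realType) (p : params R) : R := sup (range (par_q p)).
Definition sup_r (R : realType) (p : params R) : R := sup (range (par_r p)).

Definition compatible (R : realType) (pp pm : params R) : Prop :=
  sup_q pp * sup_q pm < 1 /\ sup_r pp * sup_r pm < 1.

(* Omega = [0,1] + Z^+ + (Z^+)'                                               *)
Inductive Omega (R : realType) :=
  | OPt of {i01 R}
  | OInt of nat
  | OPrime of nat.
Arguments OInt {R}.
Arguments OPrime {R}.

HB.instance Definition _ (R : realType) := gen_eqMixin (Omega R).

(* The pieces [0,1], {i}, {i'} of Omega. Throughout, `option` adjoins the     *)
(* extra symbol Sigma = None, both to Omega and to its set of pieces.         *)
Variant piece := Interval | Int of nat | Prime of nat.

Definition piece_of (R : realType) (x : Omega R) : piece :=
  match x with OPt _ => Interval | OInt i => Int i | OPrime i => Prime i end.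

(* The element of the piece a whose coordinate is u; u only matters when the  *)
(* piece is [0,1].                                                            *)
Definition place (R : realType) (a : piece) (u : {i01 R}) : Omega R :=
  match a with Interval => OPt u | Int i => OInt i | Prime i => OPrime i end.

Definition piece_of_ext (R : realType) (x : option (Omega R)) : option piece :=
  omap (@piece_of R) x.

Definition place_ext (R : realType) (a : option piece) (u : {i01 R}) :
  option (Omega R) := omap (fun b => place b u) a.

Definition in_int (R : realType) (x : Omega R) : bool :=
  if x is OInt _ then true else false.

Definition in_int_ext (R : realType) (x : option (Omega R)) : bool :=
  if x is Some y then in_int y else false.

Definition admissible_order (R : realType) (le : rel (Omega R)) : Prop :=
  [/\ total le, antisymmetric le, transitive le &
      forall x y : {i01 R}, le (OPt x) (OPt y) = (x%:num <= y%:num)].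

Definition ext_order (T : Type) (le : rel T) : rel (option T) := fun x y =>
  match x, y with
  | None, _ => true
  | Some _, None => false
  | Some x, Some y => le x y
  end.

Section multiplicity_laws.
Context {R : realType}.
Implicit Types (s : R) (pp pm : params R).

(* The second argument of poisson_prob is a dummy. poisson_prob is preferred  *)
(* to poisson_pmf because the latter is not the Dirac mass at 0 for s = 0.    *)
Definition poisson_law s : nat -> \bar R := fun k => poisson_prob s 0 [set k].

Definition geometric_law s : nat -> \bar R := fun k => ((1 - s) * s ^+ k)%:E.

Definition bernoulli_law s : nat -> \bar R := fun k =>
  match k with
  | 0%N => ((1 + s)^-1)%:E
  | 1%N => (s / (1 + s))%:E
  | _ => 0%E
  end.

Definition zero_law : nat -> \bar R := fun k => if k is 0%N then 1%E else 0%E.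

(* The law of the number of points in the cell a x b, counted with            *)
(* multiplicity.                                                              *)
Definition cell_law pp pm (a b : piece) : nat -> \bar R :=
  match a, b with
  | Interval, Interval => poisson_law (par_t pp * par_t pm)
  | Interval, Int i => poisson_law (par_t pp * par_q pm i)
  | Interval, Prime i => poisson_law (par_t pp * par_r pm i)
  | Int i, Interval => poisson_law (par_q pp i * par_t pm)
  | Prime i, Interval => poisson_law (par_r pp i * par_t pm)
  | Int i, Int j => geometric_law (par_q pp i * par_q pm j)
  | Int i, Prime j => bernoulli_law (par_q pp i * par_r pm j)
  | Prime i, Int j => bernoulli_law (par_r pp i * par_q pm j)
  | Prime i, Prime j => geometric_law (par_r pp i * par_r pm j)
  end.

Definition cell_law_ext pp pm (ap am : R) (a b : option piece) :
    nat -> \bar R :=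
  match a, b with
  | Some a, Some b => cell_law pp pm a b
  | Some Interval, None => poisson_law (am * par_t pp)
  | Some (Int i), None => bernoulli_law (am * par_q pp i)
  | Some (Prime i), None => geometric_law (am * par_r pp i)
  | None, Some Interval => poisson_law (ap * par_t pm)
  | None, Some (Int i) => bernoulli_law (ap * par_q pm i)
  | None, Some (Prime i) => geometric_law (ap * par_r pm i)
  | None, None => zero_law
  end.

End multiplicity_laws.

(* The random choices on the sample space T from which a random multiset is   *)
(* built, B being the set of pieces. The cell a x b contains mult a b points. *)
(* The k-th point of a cell [0,1] x b has first coordinate xpos b k, and the  *)
(* k-th point of a cell a x [0,1] has second coordinate ypos a k; on          *)
(* [0,1] x [0,1] both are used.                                               *)
Record choices (R : realType) (B T : Type) := Choices {
  mult : B -> B -> T -> nat ;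
  xpos : B -> nat -> T -> {i01 R} ;
  ypos : B -> nat -> T -> {i01 R}
}.

Variant choice_index (B : Type) :=
  | Mult of B & B
  | XPos of B & nat
  | YPos of B & nat.

Definition choice_value (R : realType) (B T : Type) (C : choices R B T)
    (i : choice_index B) : T -> R :=
  match i with
  | Mult a b => fun w => (mult C a b w)%:R
  | XPos b k => fun w => (xpos C b k w)%:num
  | YPos a k => fun w => (ypos C a k w)%:num
  end.

Definition mutually_independent (R : realType) (d : measure_display)
    (T : measurableType d) (P : probability T R) (I : Type)
    (X : I -> T -> R) : Prop :=
  forall (n : nat) (f : 'I_n -> I), injective f ->
  forall A : 'I_n -> set R, (forall k, measurable (A k)) ->
  P (\bigcap_k (X (f k) @^-1` A k)) =
  (\prod_(k < n) P (X (f k) @^-1` A k))%E.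

Record has_law (R : realType) (B : Type) (law : B -> B -> nat -> \bar R)
    (d : measure_display) (T : measurableType d) (P : probability T R)
    (C : choices R B T) : Prop := HasLaw {
  choice_measurable : forall i, measurable_fun setT (choice_value C i) ;
  mult_law : forall a b k, P (mult C a b @^-1` [set k]) = law a b k ;
  xpos_law : forall b k (A : set R), measurable A ->
    P (choice_value C (XPos b k) @^-1` A) = uniform_prob (@ltr01 R) A ;
  ypos_law : forall a k (A : set R), measurable A ->
    P (choice_value C (YPos a k) @^-1` A) = uniform_prob (@ltr01 R) A ;
  choice_independent : mutually_independent P (choice_value C)
}.

(* A multiset is represented by its multiplicity function.                    *)
Definition multiset_of (R : realType) (B T : Type) (X : eqType)
    (pc : X -> B) (pl : B -> {i01 R} -> X) (C : choices R B T) (w : T) :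
    X * X -> nat := fun z =>
  let a := pc z.1 in let b := pc z.2 in
  (\sum_(k < mult C a b w)
     ((pl a (xpos C b k w), pl b (ypos C a k w)) == z))%N.

Definition is_M (R : realType) (pp pm : params R) (d : measure_display)
    (T : measurableType d) (P : probability T R)
    (M : T -> Omega R * Omega R -> nat) : Prop :=
  exists2 C : choices R piece T, has_law (cell_law pp pm) P C &
    M = multiset_of (@piece_of R) (@place R) C.

Definition is_M_ext (R : realType) (pp pm : params R) (ap am : R)
    (d : measure_display) (T : measurableType d) (P : probability T R)
    (M : T -> option (Omega R) * option (Omega R) -> nat) : Prop :=
  exists2 C : choices R (option piece) T,
    has_law (cell_law_ext pp pm ap am) P C &
    M = multiset_of (@piece_of_ext R) (@place_ext R) C.

Section longest_increasing.
Context {R : realType} {X : eqType}.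
Variables (lep lem : rel X) (strict : pred X).

Definition subsequence (M : X * X -> nat) (s : seq (X * X)) : Prop :=
  forall z, (count_mem z s <= M z)%N.

Definition increasing_step : rel (X * X) := fun z z' =>
  [&& lep z.1 z'.1, lem z.2 z'.2,
      (z.1 == z'.1) ==> ~~ strict z.1 & (z.2 == z'.2) ==> ~~ strict z.2].

(* The supremum is taken in the extended reals, so it is +oo when there are   *)
(* arbitrarily long increasing subsequences.                                  *)
Definition longest_increasing (M : X * X -> nat) : \bar R :=
  ereal_sup [set ((size s)%:R)%:E | s in
    [set s | subsequence M s /\ sorted increasing_step s]].

End longest_increasing.

Definition lambda1 (R : realType) (lep lem : rel (Omega R))
    (M : Omega R * Omega R -> nat) : \bar R :=
  longest_increasing lep lem (@in_int R) M.

Definition lambda1_ext (R : realType) (lep lem : rel (Omega R))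
    (M : option (Omega R) * option (Omega R) -> nat) : \bar R :=
  longest_increasing (ext_order lep) (ext_order lem) (@in_int_ext R) M.

(* Main.v *)
(* Restricting the extended multiset to Omega x Omega, i.e. keeping only the    *)

(* Each extended multiset is restricted on its own sample space: [restrict_has_law] gives the law of
   the restriction, [lambda1_restrict] the pointwise bound, and monotonicity of the integral
   compares the expectations. The passage from [M] to the restricted multiset is
   [eq_integral_lambda1], which integrates one measurable function against two joint laws of the
   choices; [longest_increasing_labels] reduces its measurability to countably many events, and a
   pi-system argument identifies the two laws. The bound holds for each alpha in the range, hence
   for the infimum. *)
(* random choices attached to the cells without Sigma, gives a multiset with    *)
(* the law of M(p_+, p_-), whatever alpha is, and can only shorten the longest  *)
(* increasing subsequence. The two multisets live on different probability      *)
(* spaces, so it remains to see that E(lambda_1) depends only on the law of the *)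
(* choices. Naming the k-th point of the cell a x b by the label (a, b, k),     *)
(* lambda_1 is the supremum, over the countably many lists of distinct labels,  *)
(* of the length of those lists that label an increasing subsequence; hence it  *)
(* is measurable for the sigma-algebra generated by the cylinder sets, on which *)
(* the two laws of the choices agree by independence.                           *)
Require Import Defs.
From HB Require Import structures.
From mathcomp Require Import all_boot all_order all_algebra.
From mathcomp Require Import all_classical all_reals all_analysis.
From mathcomp Require Import measurable_realfun.

Set Implicit Arguments.
Unset Strict Implicit.
Unset Printing Implicit Defensive.

Import Order.TTheory GRing.Theory Num.Theory.

Local Open Scope classical_set_scope.
Local Open Scope ring_scope.

(* fib z lists the labels of z; by pigeonhole a fresh one is always available.  *)
Lemma uniq_lift_count (L Z : eqType) (pt : L -> Z) (fib : Z -> seq L) :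
  (forall z, uniq (fib z)) -> (forall z l, l \in fib z -> pt l = z) ->
  forall s : seq Z, (forall z, (count_mem z s <= size (fib z))%N) ->
  exists l : seq L, [/\ uniq l, map pt l = s & {in l, forall x, x \in fib (pt x)}].
Proof.
move=> fibU fibP; elim=> [_|z s IHs zs_le]; first by exists [::].
have [|l [lU ls lfib]] := IHs.
  by move=> y; apply: leq_trans (zs_le y); rewrite /= leq_addl.
have : ~~ all (mem l) (fib z).
  apply/negP => /allP fibl; have := zs_le z; rewrite /= eqxx add1n ltnNge.
  move/negP; apply; rewrite -ls count_map -size_filter.
  apply: uniq_leq_size => // x xz.
  by rewrite mem_filter /= (fibP _ _ xz) eqxx /=; exact: fibl.
move=> /allPn[x xz /= xl]; exists (x :: l); split => /=.
- by rewrite xl.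
- by rewrite ls (fibP _ _ xz).
- move=> y; rewrite in_cons => /predU1P[->|/lfib//].
  by rewrite (fibP _ _ xz).
Qed.

(** * Labels as names for the points of a multiset *)

Section labels.
Context {R : realType} {B : eqType} {T : Type} {X : eqType}.
Variables (pc : X -> B) (pl : B -> {i01 R} -> X) (C : choices R B T).
Hypothesis plK : forall b u, pc (pl b u) = b.

Definition label_pt (w : T) (l : B * B * nat) : X * X :=
  (pl l.1.1 (xpos C l.1.2 l.2 w), pl l.1.2 (ypos C l.1.1 l.2 w)).

Definition label_present (w : T) (l : B * B * nat) : bool :=
  (l.2 < mult C l.1.1 l.1.2 w)%N.

Definition label_fiber (w : T) (z : X * X) : seq (B * B * nat) :=
  [seq l <- [seq (pc z.1, pc z.2, k) | k <- iota 0 (mult C (pc z.1) (pc z.2) w)]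
     | label_pt w l == z].

Lemma label_fiber_uniq w z : uniq (label_fiber w z).
Proof.
by rewrite filter_uniq// map_inj_uniq ?iota_uniq// => i j [].
Qed.

(** By [plK] a label that names z belongs to the cell of z, so filtering the labels of that single
    cell loses nothing. *)
Lemma mem_label_fiber w z l :
  (l \in label_fiber w z) = label_present w l && (label_pt w l == z).
Proof.
rewrite mem_filter andbC; case: eqP => [<-|]; rewrite ?andbF// !andbT /= !plK.
case: l => -[a b] k; rewrite /label_present /=.
apply/mapP/idP => [[j]|kC]; first by rewrite mem_iota => /andP[_ jC] [->].
by exists k; rewrite // mem_iota.
Qed.

Lemma size_label_fiber w z : size (label_fiber w z) = multiset_of pc pl C w z.
Proof.
rewrite /multiset_of size_filter count_map -sum1_count big_mkcond /=.
by rewrite -{1}[mult _ _ _ _]subn0 big_mkord; apply: eq_bigr => k _ /=; case: eqP.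
Qed.

Definition increasing_labels (lep lem : rel X) (st : pred X) w
    (l : seq (B * B * nat)) : bool :=
  [&& uniq l, all (label_present w) l
    & sorted (increasing_step lep lem st) (map (label_pt w) l)].

(** Distinct present labels use each point at most as often as its multiplicity; conversely
    [uniq_lift_count] gives distinct labels to the repeated occurrences of a point. Lengths are
    preserved both ways. *)
Lemma longest_increasing_labels (lep lem : rel X) (st : pred X) w :
  longest_increasing lep lem st (multiset_of pc pl C w) =
  ereal_sup [set ((size l)%:R : R)%:E | l in
    [set l | increasing_labels lep lem st w l]].
Proof.
rewrite /longest_increasing; congr ereal_sup; apply/seteqP; split.
- move=> _ [s [sM s_inc] <-].
  have fibP z l : l \in label_fiber w z -> label_pt w l = z.
    by rewrite mem_label_fiber => /andP[_ /eqP].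
  have sfib z : (count_mem z s <= size (label_fiber w z))%N.
    by rewrite size_label_fiber.
  have [l [lU ls lfib]] := uniq_lift_count (label_fiber_uniq w) fibP sfib.
  exists l; last by rewrite -ls size_map.
  apply/and3P; split => //; last by rewrite ls.
  by apply/allP => x /lfib; rewrite mem_label_fiber => /andP[].
- move=> _ [l /and3P[lU /allP l_pres l_inc] <-].
  exists (map (label_pt w) l); last by rewrite size_map.
  split=> // z; rewrite count_map -size_filter -size_label_fiber.
  apply: uniq_leq_size; first exact: filter_uniq.
  move=> x; rewrite mem_filter mem_label_fiber => /andP[/= -> /l_pres ->].
  by [].
Qed.

End labels.

(** * Measurability of lambda_1 *)

Definition piece_code (a : piece) : option (nat + nat) :=
  match a with
  | Defs.Interval => None
  | Int i => Some (inl i)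
  | Prime i => Some (inr i)
  end.

Definition piece_decode (c : option (nat + nat)) : piece :=
  match c with
  | None => Defs.Interval
  | Some (inl i) => Int i
  | Some (inr i) => Prime i
  end.

Lemma piece_codeK : cancel piece_code piece_decode.
Proof. by case. Qed.

(** Countability of the pieces makes the lists of labels enumerable by [pickle]. *)
HB.instance Definition _ := Countable.copy piece (can_type piece_codeK).

HB.instance Definition _ (B : Type) := gen_eqMixin (choice_index B).

Lemma piece_of_place (R : realType) (a : piece) (u : {i01 R}) :
  piece_of (place a u) = a.
Proof. by case: a. Qed.

Lemma measurable_fun_lower_i01 (R : realType) (d : measure_display)
    (T : measurableType d) (D : pred {i01 R}) (u : T -> {i01 R}) :
  (forall s t, s%:num <= t%:num -> D t -> D s) ->
  measurable_fun setT (fun w => (u w)%:num : R) ->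
  measurable_fun setT (fun w => D (u w)).
Proof.
move=> Dlow mu; apply: (measurable_fun_bool true).
(* [E] is the downward closure of [D] in the real line: an interval, hence a Borel set. *)
pose E := [set x : R | exists2 t, D t & x <= t%:num].
have -> : (fun w => D (u w)) @^-1` [set true] =
    (fun w => (u w)%:num : R) @^-1` E.
  apply/seteqP; split => w /=; first by move=> Du; exists (u w).
  by move=> [t Dt ut]; exact: Dlow Dt.
apply: mu => //; apply: is_interval_measurable => x y _ [t Dt yt] z /andP[_ zy].
by exists t => //; exact: le_trans zy yt.
Qed.

(* The points of [0,1] below (or above) a fixed element of Omega form an        *)
(* interval, so an arbitrary admissible order is measurable.                    *)
Lemma measurable_fun_place_le (R : realType) (le : rel (Omega R))
    (d : measure_display) (T : measurableType d) (a b : piece)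
    (u v : T -> {i01 R}) :
  admissible_order le ->
  measurable_fun setT (fun w => (u w)%:num : R) ->
  measurable_fun setT (fun w => (v w)%:num : R) ->
  measurable_fun setT (fun w => le (place a (u w)) (place b (v w))).
Proof.
move=> [letot _ letr le01] mu mv.
have ml y : measurable_fun setT (fun w => le (OPt (u w)) y).
  apply: (@measurable_fun_lower_i01 _ _ _ (fun s => le (OPt s) y)) => // s t st.
  by apply: letr; rewrite le01.
have mr y : measurable_fun setT (fun w => le y (OPt (v w))).
  apply: (eq_measurable_fun (fun w => ~~ ~~ le y (OPt (v w)))) => [w _|].
    by rewrite negbK.
  apply: measurable_neg.
  apply: (@measurable_fun_lower_i01 _ _ _ (fun s => ~~ le y (OPt s))) => // s t st.
  by apply: contra => ys; apply: letr ys _; rewrite le01.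
case: a b => [|i|i] [|j|j] //=.
apply: (eq_measurable_fun (fun w => (u w)%:num <= (v w)%:num :> R)) => [w _|].
  by rewrite le01.
exact: measurable_fun_ler.
Qed.

Lemma measurable_fun_place_strict (R : realType) (d : measure_display)
    (T : measurableType d) (a b : piece) (u v : T -> {i01 R}) :
  measurable_fun setT (fun w =>
    (place a (u w) == place b (v w)) ==> ~~ in_int (place a (u w))).
Proof.
(* The truth value depends on the pieces only: strictness fails outside the pieces [Int i], and such
   a piece is a single point. *)
suff [c cE] : exists c : bool, forall u0 v0 : {i01 R},
    (place a u0 == place b v0) ==> ~~ in_int (place a u0) = c.
  by apply: (eq_measurable_fun (fun=> c)) => // w _; rewrite cE.
case: a => [|i|i] /=; try by exists true => u0 v0; rewrite implybT.
exists (b != Int i) => u0 v0; rewrite implybF; congr (~~ _).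
by apply/eqP/eqP => [|->//]; case: b => [|j|j] //= [->].
Qed.

Section lambda1_measurable.
Context {R : realType} {lep lem : rel (Omega R)}.
Hypotheses (hlep : admissible_order lep) (hlem : admissible_order lem).
Context {d : measure_display} {T : measurableType d} (C : choices R piece T).
Hypothesis mC : forall i, measurable_fun setT (choice_value C i).

Lemma measurable_label_present l :
  measurable_fun setT (label_present C ^~ l).
Proof.
apply: (eq_measurable_fun
    (fun w => l.2%:R < choice_value C (Mult l.1.1 l.1.2) w)) => [w _|].
  by rewrite /= ltr_nat.
exact: measurable_fun_ltr (mC _).
Qed.

Lemma measurable_label_step l l' :
  measurable_fun setT (fun w => increasing_step lep lem (@in_int R)
    (label_pt (@place R) C w l) (label_pt (@place R) C w l')).
Proof.
rewrite /increasing_step /=; apply: measurable_and.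
  exact: (measurable_fun_place_le (u := xpos C _ _) (v := xpos C _ _)
    _ _ hlep (mC (XPos _ _)) (mC (XPos _ _))).
apply: measurable_and.
  exact: (measurable_fun_place_le (u := ypos C _ _) (v := ypos C _ _)
    _ _ hlem (mC (YPos _ _)) (mC (YPos _ _))).
by apply: measurable_and; exact: measurable_fun_place_strict.
Qed.

Lemma measurable_increasing_labels l :
  measurable_fun setT (fun w =>
    increasing_labels (@place R) C lep lem (@in_int R) w l).
Proof.
rewrite /increasing_labels; apply: measurable_and; first exact: measurable_cst.
apply: measurable_and.
  elim: l => [|x l IHl] /=; first exact: measurable_cst.
  by apply: measurable_and => //; exact: measurable_label_present.
case: l => [|x l] /=; first exact: measurable_cst.
elim: l x => [|y l IHl] x /=; first exact: measurable_cst.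
by apply: measurable_and => //; exact: measurable_label_step.
Qed.

Lemma measurable_lambda1 :
  measurable_fun setT (fun w =>
    lambda1 lep lem (multiset_of (@piece_of R) (@place R) C w)).
Proof.
pose lab n : seq (piece * piece * nat) := odflt [::] (unpickle n).
pose good := fun w l => increasing_labels (@place R) C lep lem (@in_int R) w l.
(* Codes of no list decode to the empty list, and bad lists count 0. Both contribute only the length
   of the empty list, which always labels an increasing subsequence. *)
pose F n w : \bar R := if good w (lab n) then ((size (lab n))%:R)%:E else 0%:E.
apply: (eq_measurable_fun (fun w => esups (F ^~ w) 0)) => [w _|]; last first.
  apply: measurable_fun_esups => n; apply: measurable_fun_ifT => //.
  exact: measurable_increasing_labels.
rewrite /lambda1 (longest_increasing_labels _ (@piece_of_place R)) /esups /=.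
apply/eqP; rewrite eq_le; apply/andP; split.
  apply: ge_ereal_sup => _ [n _ <-]; apply: ereal_sup_ubound; rewrite /F.
  by case: ifPn => [gl|_]; [exists (lab n)|exists [::]].
apply: ge_ereal_sup => _ [l gl <-]; apply: ereal_sup_ubound; exists (pickle l) => //.
by rewrite /F /lab pickleK /= /good ifT.
Qed.

End lambda1_measurable.

(** * The joint law of the choices *)

Section same_marginals.
Context {R : realType} {B : Type} {law : B -> B -> nat -> \bar R}.
Context {d : measure_display} {T : measurableType d} {P : probability T R}.
Variable C : choices R B T.
Hypothesis CP : has_law law P C.

(** The event is a countable disjoint union of fibres of [mult], so the point masses determine its
    probability. *)
Lemma mult_value_law a b (A : set R) : measurable A ->
  P (choice_value C (Mult a b) @^-1` A) =
  (\sum_(0 <= k <oo | k \in [set k : nat | A k%:R]) law a b k)%E.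
Proof.
move=> mA; have -> : choice_value C (Mult a b) @^-1` A =
    \bigcup_(k in [set k : nat | A k%:R]) (mult C a b @^-1` [set k]).
  apply/seteqP; split => w /=; first by move=> Aw; exists (mult C a b w).
  by move=> [k Ak ->].
rewrite measure_bigcup; last 2 first.
- move=> k _.
  have -> : mult C a b @^-1` [set k] =
      choice_value C (Mult a b) @^-1` [set k%:R].
    apply/seteqP; split => w /=; first by move=> ->.
    by move=> /eqP; rewrite eqr_nat => /eqP.
  by rewrite -[X in measurable X]setTI; exact: (choice_measurable CP).
- by move=> i j _ _ [w [/= <- <-]].
by apply: eq_eseriesr => k _; exact: (mult_law CP).
Qed.

End same_marginals.

Lemma eq_choice_value_law (R : realType) (B : Type) (law : B -> B -> nat -> \bar R)
    (d d' : measure_display) (T : measurableType d) (T' : measurableType d')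
    (P : probability T R) (P' : probability T' R)
    (C : choices R B T) (C' : choices R B T') :
  has_law law P C -> has_law law P' C' ->
  forall i (A : set R), measurable A ->
  P (choice_value C i @^-1` A) = P' (choice_value C' i @^-1` A).
Proof.
move=> CP CP' [a b|b k|a k] A mA.
- by rewrite (mult_value_law CP)// (mult_value_law CP').
- by rewrite (xpos_law CP)// (xpos_law CP').
- by rewrite (ypos_law CP)// (ypos_law CP').
Qed.

Section choice_space.
Context (R : realType) (B : Type).

(* Choices on the one-point sample space serve as joint values of all the      *)
(* random choices.                                                             *)
HB.instance Definition _ := gen_eqMixin (choices R B unit).
HB.instance Definition _ := gen_choiceMixin (choices R B unit).
HB.instance Definition _ := isPointed.Build (choices R B unit)
  (Choices (fun _ _ => cst 0%N) (fun _ _ => cst (widen_itv 0%:itv))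
     (fun _ _ => cst (widen_itv 0%:itv))).

Definition cylinder (s : seq (choice_index B)) (A : choice_index B -> set R) :
    set (choices R B unit) :=
  [set c | forall i, i \in s -> A i (choice_value c i tt)].

Definition cylinders : set (set (choices R B unit)) :=
  [set D | exists s A, (forall i, measurable (A i)) /\ D = cylinder s A].

Lemma cylinders_setI : setI_closed cylinders.
Proof.
move=> _ _ [s1 [A1 [mA1 ->]]] [s2 [A2 [mA2 ->]]].
(* Each condition is padded with the whole line outside its own list of indices. *)
exists (s1 ++ s2), (fun i => (if i \in s1 then A1 i else setT) `&`
                             (if i \in s2 then A2 i else setT)); split.
  by move=> i; apply: measurableI; case: ifP.
apply/seteqP; split => c /=.
  move=> [c1 c2] i _; split; case: ifP => // is_; [exact: c1|exact: c2].
by move=> c12; split => i is_; have := c12 i; rewrite mem_cat is_ ?orbT;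
   case/(_ isT).
Qed.

Definition choice_space := g_sigma_algebraType cylinders.

Definition canonical_choices : choices R B choice_space := Choices
  (fun a b c => mult c a b tt) (fun b k c => xpos c b k tt)
  (fun a k c => ypos c a k tt).

Lemma measurable_canonical_choices i :
  measurable_fun setT (choice_value canonical_choices i).
Proof.
move=> _ A mA; rewrite setTI; apply: sub_sigma_algebra.
exists [:: i], (fun=> A); split => //; apply/seteqP.
split => c /= Ac; last by move: (Ac i); rewrite inE eqxx => /(_ isT); case: (i).
by move=> j; rewrite inE => /eqP ->; case: (i) Ac.
Qed.

Section realize.
Context {d : measure_display} {T : measurableType d}.
Variable C : choices R B T.

Definition realize (w : T) : choice_space := Choices
  (fun a b _ => mult C a b w) (fun b k _ => xpos C b k w)
  (fun a k _ => ypos C a k w).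

Lemma choice_value_realize w i :
  choice_value (realize w : choices R B unit) i tt = choice_value C i w.
Proof. by case: i. Qed.

(** Removing the repetitions of [s] makes the index map injective, as [mutually_independent]
    requires. *)
Lemma realize_cylinder s A :
  realize @^-1` cylinder s A = \bigcap_(k : 'I_(size (undup s)))
    (choice_value C (tnth (in_tuple (undup s)) k) @^-1`
       A (tnth (in_tuple (undup s)) k)).
Proof.
apply/seteqP; split => w /=.
  move=> wA k _ /=; rewrite -choice_value_realize; apply: wA.
  by rewrite -mem_undup; exact: mem_tnth.
move=> wA i; rewrite -mem_undup => /(@tnthP _ _ (in_tuple _))[k ->].
by rewrite choice_value_realize; exact: wA.
Qed.

Hypothesis mC : forall i, measurable_fun setT (choice_value C i).

Lemma measurable_realize : measurable_fun setT realize.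
Proof.
apply: (@measurability _ _ _ (g_sigma_algebraType cylinders) _ _ cylinders).
  by [].
move=> _ [_ [s [A [mA ->]]] <-].
rewrite setTI realize_cylinder; apply: fin_bigcap_measurable => // k _.
by rewrite -[X in measurable X]setTI; exact: mC.
Qed.

End realize.

End choice_space.

(** Both sides are integrals of the same [L] on [choice_space], against the image laws under
    [realize]. On cylinders, which are stable under intersection, independence turns both laws into
    products of equal marginals. *)
Lemma eq_integral_lambda1 (R : realType) (lep lem : rel (Omega R))
    (law : piece -> piece -> nat -> \bar R)
    (d d' : measure_display) (T : measurableType d) (T' : measurableType d')
    (P : probability T R) (P' : probability T' R)
    (C : choices R piece T) (C' : choices R piece T') :
  admissible_order lep -> admissible_order lem ->
  has_law law P C -> has_law law P' C' ->
  (\int[P]_w lambda1 lep lem (multiset_of (@piece_of R) (@place R) C w) =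
   \int[P']_w lambda1 lep lem (multiset_of (@piece_of R) (@place R) C' w))%E.
Proof.
move=> hlep hlem CP CP'.
pose C0 := canonical_choices R piece.
pose L c := lambda1 lep lem (multiset_of (@piece_of R) (@place R) C0 c).
have mL : measurable_fun setT L.
  exact: measurable_lambda1 (@measurable_canonical_choices _ _).
have L0 c : (0 <= L c)%E by apply: ereal_sup_ubound; exists [::].
have mX := measurable_realize (choice_measurable CP).
have mX' := measurable_realize (choice_measurable CP').
transitivity (\int[pushforward P (realize C)]_c L c)%E.
  by rewrite ge0_integral_pushforward.
transitivity (\int[pushforward P' (realize C')]_c L c)%E; last first.
  by rewrite ge0_integral_pushforward.
apply: eq_measure_integral => D mD _.
apply: (@measure_unique _ _ (g_sigma_algebraType (@cylinders R piece))
    (@cylinders R piece) (fun=> setT)) => //.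
- exact: cylinders_setI.
(* The whole space is the cylinder over no index. *)
- move=> _; exists [::], (fun=> setT); split => //.
  by apply/seteqP; split.
- by rewrite bigcup_const.
- move=> _ [s [A [mA ->]]]; rewrite /= /pushforward !realize_cylinder.
  have tnth_inj : injective (tnth (in_tuple (undup s))).
    by apply/tuple_uniqP; rewrite undup_uniq.
  rewrite (choice_independent CP)// (choice_independent CP')//.
  by apply: eq_bigr => k _; exact: eq_choice_value_law CP CP' _ _ _.
- move=> _; rewrite /= /pushforward preimage_setT probability_setT.
  exact: ltry.
Qed.

(** * Restriction to the cells without Sigma *)

Definition restrict_choices (R : realType) (B T : Type)
    (C : choices R (option B) T) : choices R B T := Choices
  (fun a b => mult C (Some a) (Some b)) (fun b => xpos C (Some b))
  (fun a => ypos C (Some a)).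

(** Independence passes to injectively indexed subfamilies, here along [emb]. *)
Lemma restrict_has_law (R : realType) (B : Type)
    (law : option B -> option B -> nat -> \bar R)
    (d : measure_display) (T : measurableType d) (P : probability T R)
    (C : choices R (option B) T) :
  has_law law P C ->
  has_law (fun a b => law (Some a) (Some b)) P (restrict_choices C).
Proof.
move=> CP; pose emb (i : choice_index B) : choice_index (option B) :=
  match i with
  | Mult a b => Mult (Some a) (Some b)
  | XPos b k => XPos (Some b) k
  | YPos a k => YPos (Some a) k
  end.
have embE i : choice_value (restrict_choices C) i = choice_value C (emb i).
  by case: i.
have emb_inj : injective emb.
  by move=> [a b|b k|a k] [a' b'|b' k'|a' k'] //= [-> ->].
split.
- by move=> i; rewrite embE; exact: (choice_measurable CP).
- by move=> a b k; exact: (mult_law CP).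
- by move=> b k A mA; rewrite embE (xpos_law CP).
- by move=> a k A mA; rewrite embE (ypos_law CP).
- move=> n f f_inj A mA; under eq_bigcapr do rewrite embE.
  under eq_bigr do rewrite embE.
  exact: (choice_independent CP (inj_comp emb_inj f_inj)).
Qed.

Lemma multiset_of_restrict (R : realType) (T : Type)
    (C : choices R (option piece) T) (w : T) (x y : Omega R) :
  multiset_of (@piece_of R) (@place R) (restrict_choices C) w (x, y) =
  multiset_of (@piece_of_ext R) (@place_ext R) C w (Some x, Some y).
Proof. by []. Qed.

(** Applying [Some] to both coordinates preserves the orders, strictness and multiplicities, so it
    carries increasing subsequences to increasing subsequences of the same length. *)
Lemma lambda1_restrict (R : realType) (lep lem : rel (Omega R)) (T : Type)
    (C : choices R (option piece) T) (w : T) :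
  (lambda1 lep lem
     (multiset_of (@piece_of R) (@place R) (restrict_choices C) w) <=
   lambda1_ext lep lem
     (multiset_of (@piece_of_ext R) (@place_ext R) C w))%E.
Proof.
apply: ge_ereal_sup => _ [s [sM s_inc] <-]; apply: ereal_sup_ubound.
pose some2 (z : Omega R * Omega R) := (Some z.1, Some z.2).
have some2_inj : injective some2 by move=> [x y] [x' y'] [-> ->].
exists (map some2 s); last by rewrite size_map.
split; last by rewrite sorted_map.
move=> z; have [/mapP[[x y] _ ->]|/count_memPn->//] := boolP (z \in map some2 s).
rewrite -multiset_of_restrict count_map.
have /eq_count -> : preim some2 (pred1 (Some x, Some y)) =1 pred1 (x, y).
  by move=> t; rewrite /= -(inj_eq some2_inj).
exact: sM.
Qed.

(* The integral of a nonnegative function, measurable or not, is the supremum  *)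
(* of the integrals of the simple functions below it.                          *)
Lemma le_integral_nonneg (R : realType) (d : measure_display)
    (T : measurableType d) (mu : {measure set T -> \bar R}) (f g : T -> \bar R) :
  (forall w, (0 <= f w)%E) -> (forall w, (f w <= g w)%E) ->
  (\int[mu]_w f w <= \int[mu]_w g w)%E.
Proof.
move=> f0 fg; have g0 w : (0 <= g w)%E by exact: le_trans (fg w).
rewrite !ge0_integralTE//; apply: ereal_sup_le => _ [h hf <-].
by exists h => // w; exact: le_trans (fg w).
Qed.

Theorem theorem5p1 (R : realType) (pp pm : params R)
    (hcompat : compatible pp pm)
    (lep lem : rel (Omega R))
    (hlep : admissible_order lep) (hlem : admissible_order lem)
    (d : measure_display) (T : measurableType d) (P : probability T R)
    (M : T -> Omega R * Omega R -> nat)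
    (hM : is_M pp pm P M)
    (de : R -> measure_display) (Te : forall a : R, measurableType (de a))
    (Pe : forall a : R, probability (Te a) R)
    (Me : forall a : R, Te a -> option (Omega R) * option (Omega R) -> nat)
    (hMe : forall a : R,
       ((sup_r pp)%:E < a%:E < ((sup_r pm)%:E)^-1)%E ->
       is_M_ext pp pm a a^-1 (Pe a) (Me a)) :
  (\int[P]_w lambda1 lep lem (M w) <=
   ereal_inf [set \int[Pe a]_w lambda1_ext lep lem (Me a w) | a in
     [set a : R | (sup_r pp)%:E < a%:E < ((sup_r pm)%:E)^-1]])%E.
Proof.
apply: le_ereal_inf_tmp => _ [a /hMe[Ce CeP ->] <-]; case: hM => C CP ->.
have := restrict_has_law CeP.
(* Away from Sigma the laws agree by computation in each cell, and alpha does not enter. *)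
have -> : (fun x y => cell_law_ext pp pm a a^-1 (Some x) (Some y)) =
    cell_law pp pm.
  by apply/funext => -[|i|i]; apply/funext => -[|j|j].
move=> /(eq_integral_lambda1 hlep hlem CP) ->.
apply: le_integral_nonneg => w; last exact: lambda1_restrict.
by apply: ereal_sup_ubound; exists [::].
Qed.
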